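(* 1. In an integral ring $A$, a faithful finitely generated ideal is divisorially invertible if and only if there exists a sequence $(s_1,\dots,s_p)$ in $A$ of depth $\geq2$ such that, after localization at each $s_i$ (i.e. in each ring $A[\frac1{s_i}]$), the ideal becomes principal. 2. Consequently, an integral ring $A$ is a ring with divisors if and only if every finitely generated ideal becomes principal after localization at the elements of some sequence of depth $\geq 2$.
   Context: Rings are commutative with unit. A ring is integral if every element is zero or regular (the trivial ring is not excluded); $A^*$ is the set of regular elements. An ideal is faithful if its annihilator is $0$; for a nontrivial integral ring a finitely generated ideal is faithful iff it is nonzero. Depth: a list $(a_1,\dots,a_n)$ has depth $\ge1$ if $a_1x=\dots=a_nx=0$ implies $x=0$. It has depth $\ge2$ if moreover every list $(x_1,\dots,x_n)$ with $a_ix_j=a_jx_i$ for all $i,j$ is of the form $x_j=xa_j$ (all $j$) for some $x$. An element $g\in A^*$ is a strong gcd of $(a_1,\dots,a_n)$ in $A^*$ if for every $x\in A^*$, $xg$ is a gcd of $(xa_1,\dots,xa_n)$ in $A$; this depends only on the ideal generated by the $a_i$. A finitely generated faithful ideal $\mathfrak a$ is divisorially invertible if there is a finitely generated ideal $\mathfrak b$ such that $\mathfrak a\mathfrak b$ has a strong gcd in $A^*$ (zero generators are disregarded). An integral ring is a ring with divisors (PvMD) if every nonzero finitely generated ideal is divisorially invertible. *)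

(* Defs.v *)
(* MathComp, with boolp only to make the equality of A[1/s] decidable. *)
From HB Require Import structures.
From mathcomp Require Import all_boot all_algebra.
From mathcomp Require Import boolp ring.

Set Implicit Arguments.
Unset Strict Implicit.
Unset Printing Implicit Defensive.

Import GRing.Theory.
Local Open Scope ring_scope.
Local Open Scope quotient_scope.

Ltac ring_exp := rewrite ?exprD ?expr0; ring.

(* The ring A[1/s]: the pair (a, n) stands for a / s^n. No hypothesis is made
   on s; in particular A[1/0] is the trivial ring. *)
Section Localization.
Variables (A : comPzRingType) (s : A).

Definition loc_rel (u v : A * nat) : bool :=
  `[< exists k, s ^+ k * (s ^+ v.2 * u.1) = s ^+ k * (s ^+ u.2 * v.1) >].

Lemma loc_rel_refl : reflexive loc_rel.
Proof. by move=> u; apply/asboolP; exists 0. Qed.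

Lemma loc_rel_sym : symmetric loc_rel.
Proof.
by move=> u v; apply/asboolP/asboolP => -[k e]; exists k.
Qed.

Lemma loc_rel_trans : transitive loc_rel.
Proof.
move=> [b m] [a n] [c p] /asboolP[k /= e1] /asboolP[l /= e2].
apply/asboolP; exists (k + l + m)%N => /=.
transitivity (s ^+ (l + p) * (s ^+ k * (s ^+ m * a))); first ring_exp.
rewrite e1; transitivity (s ^+ (k + n) * (s ^+ l * (s ^+ p * b))); first ring_exp.
rewrite e2; ring_exp.
Qed.

Canonical loc_equiv := EquivRel loc_rel loc_rel_refl loc_rel_sym loc_rel_trans.

Definition loc := {eq_quot loc_rel}.

HB.instance Definition _ : EqQuotient _ loc_rel loc := EqQuotient.on loc.
HB.instance Definition _ := Choice.on loc.

Definition loc_frac (a : A) (n : nat) : loc := \pi_loc (a, n).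

Lemma loc_fracP a n b m :
  loc_frac a n = loc_frac b m <->
  exists k, s ^+ k * (s ^+ m * a) = s ^+ k * (s ^+ n * b).
Proof.
split=> [/eqmodP/asboolP // | e]; exact/eqmodP/asboolP.
Qed.

Lemma loc_fracW (P : loc -> Prop) :
  (forall a n, P (loc_frac a n)) -> forall u, P u.
Proof. by move=> H; elim/quotW => -[a n]; apply: H. Qed.

Definition loc_add_pair (u v : A * nat) : A * nat :=
  (s ^+ v.2 * u.1 + s ^+ u.2 * v.1, (u.2 + v.2)%N).
Definition loc_opp_pair (u : A * nat) : A * nat := (- u.1, u.2).
Definition loc_mul_pair (u v : A * nat) : A * nat :=
  (u.1 * v.1, (u.2 + v.2)%N).

Definition loc_add (u v : loc) : loc := \pi_loc (loc_add_pair (repr u) (repr v)).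
Definition loc_opp (u : loc) : loc := \pi_loc (loc_opp_pair (repr u)).
Definition loc_mul (u v : loc) : loc := \pi_loc (loc_mul_pair (repr u) (repr v)).

Lemma repr_frac a n : exists k,
  s ^+ k * (s ^+ n * (repr (loc_frac a n)).1)
  = s ^+ k * (s ^+ (repr (loc_frac a n)).2 * a).
Proof.
apply/loc_fracP; rewrite {1}/loc_frac -surjective_pairing; exact: reprK.
Qed.

Lemma loc_addE a n b m :
  loc_add (loc_frac a n) (loc_frac b m)
  = loc_frac (s ^+ m * a + s ^+ n * b) (n + m).
Proof.
have [k ek] := repr_frac a n; have [l el] := repr_frac b m.
rewrite /loc_add /loc_add_pair; apply/loc_fracP; exists (k + l)%N.
case: (repr (loc_frac a n)) (repr (loc_frac b m)) ek el => [a' n'] [b' m'] /= ek el.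
transitivity (s ^+ (l + m + m') * (s ^+ k * (s ^+ n * a'))
  + s ^+ (k + n + n') * (s ^+ l * (s ^+ m * b'))); first ring_exp.
rewrite ek el; ring_exp.
Qed.

Lemma loc_oppE a n : loc_opp (loc_frac a n) = loc_frac (- a) n.
Proof.
have [k ek] := repr_frac a n.
by apply/loc_fracP; exists k; rewrite !mulrN ek.
Qed.

Lemma loc_mulE a n b m :
  loc_mul (loc_frac a n) (loc_frac b m) = loc_frac (a * b) (n + m).
Proof.
have [k ek] := repr_frac a n; have [l el] := repr_frac b m.
rewrite /loc_mul /loc_mul_pair; apply/loc_fracP; exists (k + l)%N.
case: (repr (loc_frac a n)) (repr (loc_frac b m)) ek el => [a' n'] [b' m'] /= ek el.
transitivity ((s ^+ k * (s ^+ n * a')) * (s ^+ l * (s ^+ m * b'))); first ring_exp.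
rewrite ek el; ring_exp.
Qed.

Lemma loc_addA : associative loc_add.
Proof.
elim/loc_fracW => a n; elim/loc_fracW => b m; elim/loc_fracW => c p.
by rewrite !loc_addE; apply/loc_fracP; exists 0%N; ring_exp.
Qed.

Lemma loc_addC : commutative loc_add.
Proof.
elim/loc_fracW => a n; elim/loc_fracW => b m.
by rewrite !loc_addE addrC addnC.
Qed.

Lemma loc_add0 : left_id (loc_frac 0 0) loc_add.
Proof.
by elim/loc_fracW => a n; rewrite loc_addE mulr0 add0r expr0 mul1r.
Qed.

Lemma loc_addN : left_inverse (loc_frac 0 0) loc_opp loc_add.
Proof.
elim/loc_fracW => a n; rewrite loc_oppE loc_addE.
by apply/loc_fracP; exists 0%N; ring_exp.
Qed.

HB.instance Definition _ :=
  GRing.isZmodule.Build loc loc_addA loc_addC loc_add0 loc_addN.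

Lemma loc_mulA : associative loc_mul.
Proof.
elim/loc_fracW => a n; elim/loc_fracW => b m; elim/loc_fracW => c p.
by rewrite !loc_mulE mulrA addnA.
Qed.

Lemma loc_mulC : commutative loc_mul.
Proof.
by elim/loc_fracW => a n; elim/loc_fracW => b m; rewrite !loc_mulE mulrC addnC.
Qed.

Lemma loc_mul1 : left_id (loc_frac 1 0) loc_mul.
Proof. by elim/loc_fracW => a n; rewrite loc_mulE mul1r. Qed.

Lemma loc_mulDl : left_distributive loc_mul loc_add.
Proof.
elim/loc_fracW => a n; elim/loc_fracW => b m; elim/loc_fracW => c p.
rewrite !(loc_addE, loc_mulE); apply/loc_fracP; exists 0%N; ring_exp.
Qed.

HB.instance Definition _ :=
  GRing.Zmodule_isComPzRing.Build loc loc_mulA loc_mulC loc_mul1 loc_mulDl.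

Definition to_loc (a : A) : loc := loc_frac a 0.

Lemma to_loc_is_zmod_morphism : zmod_morphism to_loc.
Proof.
move=> a b; have subE (u v : loc) : u - v = loc_add u (loc_opp v) by [].
by rewrite subE loc_oppE loc_addE !mul1r.
Qed.

Lemma to_loc_is_monoid_morphism : monoid_morphism to_loc.
Proof. by split=> // a b; rewrite [RHS]loc_mulE. Qed.

HB.instance Definition _ :=
  GRing.isZmodMorphism.Build A loc to_loc to_loc_is_zmod_morphism.
HB.instance Definition _ :=
  GRing.isMonoidMorphism.Build A loc to_loc to_loc_is_monoid_morphism.

Lemma to_loc_inv : to_loc s * loc_frac 1 1 = 1.
Proof.
rewrite [LHS]loc_mulE; apply/(loc_fracP _ _ 1 0); exists 0%N; ring_exp.
Qed.

Lemma loc_fracE a n : loc_frac a n = to_loc a * loc_frac 1 1 ^+ n.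
Proof.
elim: n a => [|n IHn] a; first by rewrite expr0 mulr1.
by rewrite exprSr mulrA -IHn [RHS]loc_mulE mulr1 addn1.
Qed.

End Localization.

Section Divisors.
Variable A : comPzRingType.
Implicit Types (I : A -> Prop) (a b s l : seq A) (x y g : A).

(* GRing.lreg is regularity; the trivial ring is integral. *)
Definition integral_ring := forall x, x = 0 \/ GRing.lreg x.

(* The ideal generated by a finite list. Finitely generated ideals are
   represented by lists of generators. *)
Definition ideal_gen a : A -> Prop :=
  fun x => exists c : 'I_(size a) -> A, x = \sum_(i < size a) c i * a`_i.

Definition faithful I := forall x, (forall y, I y -> x * y = 0) -> x = 0.

Definition nonzero_ideal I := exists2 x, I x & x <> 0.

Definition principal I := exists g, forall x, I x <-> ideal_gen [:: g] x.

Definition depth_ge1 a := forall x, (forall i, (i < size a)%N -> a`_i * x = 0) -> x = 0.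

Definition depth_ge2 a :=
  depth_ge1 a /\
  forall l, size l = size a ->
    (forall i j, (i < size a)%N -> (j < size a)%N -> a`_i * l`_j = a`_j * l`_i) ->
    exists x, forall j, (j < size a)%N -> l`_j = x * a`_j.

Definition divides x y := exists z, y = z * x.

Definition is_gcd g l :=
  (forall x, x \in l -> divides g x) /\
  forall y, (forall x, x \in l -> divides y x) -> divides y g.

Definition strong_gcd g l :=
  [/\ GRing.lreg g, {in l, forall y, GRing.lreg y} &
    forall x, GRing.lreg x -> is_gcd (x * g) [seq x * y | y <- l]].

(* Generators of the product of two ideals, the zero ones being dropped. *)
Definition prod_gens a b : seq A := [seq z <- [seq x * y | x <- a, y <- b] | z != 0].

Definition div_invertible a :=
  faithful (ideal_gen a) /\ exists b g, strong_gcd g (prod_gens a b).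

Definition ring_with_divisors :=
  integral_ring /\
  forall a, nonzero_ideal (ideal_gen a) -> div_invertible a.

End Divisors.

Arguments integral_ring A : clear implicits.
Arguments ring_with_divisors A : clear implicits.

Definition locally_principal (A : comPzRingType) (s a : seq A) :=
  forall t, t \in s -> principal (ideal_gen [seq to_loc t x | x <- a]).

(* Main.v *)
(** If [g] is the strong gcd of the products [a_i b_j = c_ij g], then
    [a_k c_ij = c_kj a_i], so [a_i] generates the ideal once [c_ij] is
    inverted, and cancelling [g] in the strong gcd condition shows that the
    [c_ij] have depth at least 2.

    Conversely, clearing denominators gives, for each [t] in [s], an element
    [g_t] of the ideal with [t ^ N_t a_k] a multiple of [g_t] for all [k]. Let
    [G] be the product of the [g_t] and [b_t = t ^ N_t G / g_t]. Then [G]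
    divides every [a_k b_t], and a common divisor of the [x a_k b_t] divides
    [x g_t b_t = x G t ^ N_t] for every [t], hence divides [x G] because the
    powers of a sequence of depth at least 2 again have depth at least 2. *)
Require Import Defs.
From mathcomp Require Import all_boot all_algebra.
From mathcomp Require Import boolp ring.

Set Implicit Arguments.
Unset Strict Implicit.
Unset Printing Implicit Defensive.

Import GRing.Theory.
Local Open Scope ring_scope.

(** * Finitely generated ideals and divisibility *)

Section Ideals.
Variable A : comPzRingType.
Implicit Types (a s : seq A) (x y z g : A).

Lemma ideal_gen_ind a (P : A -> Prop) :
    P 0 -> (forall x y, P x -> P y -> P (x + y)) ->
    (forall c x, x \in a -> P (c * x)) ->
  forall x, ideal_gen a x -> P x.
Proof.
move=> P0 PD PM x [c ->]; apply: big_ind => // i _.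
by apply: PM; apply: mem_nth.
Qed.

Lemma ideal_gen0 a : ideal_gen a 0.
Proof. by exists (fun=> 0); rewrite big1 // => i _; rewrite mul0r. Qed.

Lemma ideal_genD a x y : ideal_gen a x -> ideal_gen a y -> ideal_gen a (x + y).
Proof.
move=> [c ->] [d ->]; exists (fun i => c i + d i).
by rewrite -big_split; apply: eq_bigr => i _; rewrite mulrDl.
Qed.

Lemma ideal_genM a z x : ideal_gen a x -> ideal_gen a (z * x).
Proof.
move=> [c ->]; exists (fun i => z * c i).
by rewrite mulr_sumr; apply: eq_bigr => i _; rewrite mulrA.
Qed.

Lemma mem_ideal_gen a x : x \in a -> ideal_gen a x.
Proof.
move=> xa; have lt_xa : (index x a < size a)%N by rewrite index_mem.
exists (fun i => (i == Ordinal lt_xa)%:R).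
rewrite (bigD1 (Ordinal lt_xa)) //= eqxx mul1r nth_index // big1 ?addr0 //.
by move=> i /negPf ->; rewrite mul0r.
Qed.

Lemma ideal_gen1P g x : ideal_gen [:: g] x <-> divides g x.
Proof.
split=> [[c ->]|[z ->]]; first by exists (c ord0); rewrite big_ord1.
by apply/ideal_genM/mem_ideal_gen; rewrite inE.
Qed.

Lemma divides0 g : divides g 0.
Proof. by exists 0; rewrite mul0r. Qed.

Lemma dividesD g x y : divides g x -> divides g y -> divides g (x + y).
Proof. by move=> [u ->] [v ->]; exists (u + v); rewrite mulrDl. Qed.

Lemma dividesMl g z x : divides g x -> divides g (z * x).
Proof. by move=> [u ->]; exists (z * u); rewrite mulrA. Qed.

Lemma principal_divides a g :
    ideal_gen a g -> (forall x, x \in a -> divides g x) ->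
  principal (ideal_gen a).
Proof.
move=> ag dv; exists g => x; split=> [|/ideal_gen1P[z ->]]; last exact: ideal_genM.
move=> ax; apply/ideal_gen1P; move: x ax; apply: ideal_gen_ind.
- exact: divides0.
- by move=> x y; apply: dividesD.
- by move=> c x /dv; apply: dividesMl.
Qed.

(** * Divisibility tested along a sequence of depth at least 2 *)

Lemma depth_ge2_one : depth_ge2 [:: 1 : A].
Proof.
split=> [x /(_ 0%N isT)|l _ _]; first by rewrite /= mul1r.
by exists l`_0 => -[|j] // _; rewrite mulr1.
Qed.

(** For [y] regular, the quotients of the [x * t] by [y] are proportional to [s], so depth 2 gives
    them a common factor [w], and [s] kills [x - w * y]. For [y = 0], [s] kills [x]. *)
Lemma depth_ge2_divides s x y :
    integral_ring A -> depth_ge2 s ->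
    (forall t, t \in s -> divides y (x * t)) ->
  divides y x.
Proof.
move=> hA [s1 s2] dv.
have [y0|yreg] := hA y.
  suff -> : x = 0 by apply: divides0.
  apply: s1 => i lt_is; have [z] := dv _ (mem_nth 0 lt_is).
  by rewrite y0 mulr0 mulrC.
have /choice[q qE] : forall t, exists z, t \in s -> x * t = z * y.
  move=> t; have [ts|_] := boolP (t \in s); last by exists 0.
  by have [z zE] := dv t ts; exists z.
have nthq i : (i < size s)%N -> (map q s)`_i = q s`_i.
  by move=> lt_is; rewrite (nth_map 0).
have [||w wE] := s2 (map q s); first by rewrite size_map.
  move=> i j lt_is lt_js; rewrite !nthq //; apply: yreg.
  have ei := qE _ (mem_nth 0 lt_is); have ej := qE _ (mem_nth 0 lt_js).
  transitivity (s`_i * (q s`_j * y)); first by ring.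
  rewrite -ej; transitivity (s`_j * (x * s`_i)); first by ring.
  by rewrite ei; ring.
exists w; apply/eqP; rewrite -subr_eq0; apply/eqP/s1 => i lt_is.
have ei := qE _ (mem_nth 0 lt_is); rewrite -nthq // wE // in ei.
rewrite mulrBr mulrC ei; ring.
Qed.

Lemma depth_ge2_divides_exp s x y (N : A -> nat) :
    integral_ring A -> depth_ge2 s ->
    (forall t, t \in s -> divides y (x * t ^+ N t)) ->
  divides y x.
Proof.
(* Induction on the total exponent; [undup] counts each exponent once, so lowering one of them
   lowers the sum by exactly 1. *)
move=> hA s2; have [n] := ubnP (\sum_(t <- undup s) N t).
elim: n N x => // n IHn N x leNn dv; apply: (depth_ge2_divides hA s2) => t ts.
case Nt: (N t) => [|m].
  by have := dv t ts; rewrite Nt mulr1 mulrC => /dividesMl.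
(* One factor [t] moves from the power into [x]. *)
pose N' r := if r == t then m else N r.
apply: (IHn N') => [|r rs]; last first.
  rewrite /N'; case: eqP => [->|_]; first by have := dv t ts; rewrite Nt exprS mulrA.
  by rewrite mulrAC mulrC; apply/dividesMl/dv.
apply: leq_trans (leNn : (\sum_(t <- undup s) N t <= n)%N).
have ts' : t \in undup s by rewrite mem_undup.
rewrite !(bigD1_seq t ts' (undup_uniq s)) /= /N' eqxx Nt addSn ltnS leq_add2l.
by apply: leq_sum => r /negPf ->.
Qed.

(** * Product generators and strong gcds *)

Lemma mem_prod_gens a b x y :
  x \in a -> y \in b -> x * y != 0 -> x * y \in prod_gens a b.
Proof. by move=> xa yb nz; rewrite mem_filter nz; apply: allpairs_f. Qed.

Lemma prod_gensP a b z : z \in prod_gens a b ->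
  exists x y, [/\ x \in a, y \in b, z = x * y & z != 0].
Proof.
rewrite mem_filter => /andP[nz /allpairsP[[x y] /= [xa yb zE]]].
by exists x, y.
Qed.

Lemma strong_gcd_depth_ge2 (q : A -> A) g l :
    integral_ring A -> strong_gcd g l -> {in l, forall y, y = q y * g} ->
  depth_ge2 [seq q y | y <- l].
Proof.
move=> hA [greg lregs gcdl] qE.
have nthq i : (i < size l)%N -> l`_i = (map q l)`_i * g.
  by move=> lt_il; rewrite (nth_map 0) //; apply/qE/mem_nth.
have qreg i : (i < size l)%N -> GRing.lreg (map q l)`_i.
  move=> lt_il u v e; apply: (lregs _ (mem_nth 0 lt_il)).
  by rewrite nthq // ![_ * g]mulrC -!mulrA e.
case: l lregs gcdl qE nthq qreg => [|y0 l0] lregs gcdl qE nthq qreg.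
  (* [g] is a gcd of the empty list, so [0] divides [g]. *)
  have [_ /(_ 0)[//|z]] := gcdl 1 (@lreg1 _).
  rewrite mulr0 mul1r => g0.
  have z0 x : x = 0 :> A by apply: greg; rewrite g0 !mul0r.
  by split=> [x _|m _ _]; [apply: z0 | exists 0].
set l := y0 :: l0 in lregs gcdl qE nthq qreg *.
split=> [x /(_ 0%N isT) e|m sz_m comm].
  by apply: (qreg 0%N isT); rewrite mulr0.
rewrite size_map in comm *.
(* The other coordinates follow by cancelling the regular first quotient. *)
suff [x xE] : divides (map q l)`_0 m`_0.
  exists x => j lt_jl; apply: (qreg 0%N isT).
  by rewrite comm // xE; ring.
have [->|m0reg] := hA m`_0; first exact: divides0.
(* With multiplier [m_0], proportionality gives [m_0 q_i g = m_i q_0 g], so [q_0 g] is a common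
   divisor and divides [m_0 g]. *)
have [_ /(_ ((map q l)`_0 * g))[_ /mapP[y yl ->]|z zE]] := gcdl _ m0reg.
  have lt_yl : (index y l < size l)%N by rewrite index_mem.
  exists m`_(index y l); rewrite -{1}(nth_index 0 yl) nthq // mulrA.
  by rewrite [m`_0 * _]mulrC -comm //; ring.
exists z; apply: greg; rewrite mulrC zE; ring.
Qed.

End Ideals.

(** * Clearing denominators in [A[1/t]] *)

Section LocalPrincipality.
Variable A : comPzRingType.
Implicit Types (a s : seq A) (t x : A).

Lemma to_loc_eq t x y : to_loc t x = to_loc t y ->
  exists n, t ^+ n * x = t ^+ n * y.
Proof. by move=> /loc_fracP[n]; rewrite !expr0 !mul1r; exists n. Qed.

Lemma loc_clear t (u : loc t) : exists n x, to_loc t (t ^+ n) * u = to_loc t x.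
Proof.
elim/loc_fracW: u => x n; exists n, x.
rewrite loc_fracE mulrCA rmorphXn -exprMn to_loc_inv expr1n mulr1 //.
Qed.

Lemma ideal_gen_loc_clear t a (u : loc t) :
    ideal_gen [seq to_loc t y | y <- a] u ->
  exists n g, ideal_gen a g /\ to_loc t (t ^+ n) * u = to_loc t g.
Proof.
move: u; apply: ideal_gen_ind.
- by exists 0%N, 0; split; [apply: ideal_gen0 | rewrite mulr0 rmorph0].
- move=> u v [n [g [ag ug]]] [m [h [ah vh]]].
  exists (n + m)%N, (t ^+ m * g + t ^+ n * h); split.
    by apply: ideal_genD; apply: ideal_genM.
  by rewrite exprD !(rmorphD, rmorphM) /= -ug -vh; ring.
- move=> c _ /mapP[x xa ->]; have [n [d cE]] := loc_clear c.
  exists n, (d * x); split; first exact/ideal_genM/mem_ideal_gen.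
  by rewrite mulrA cE rmorphM.
Qed.

Lemma principal_loc_descent t a :
    principal (ideal_gen [seq to_loc t x | x <- a]) ->
  exists N g, ideal_gen a g /\ forall x, x \in a -> divides g (t ^+ N * x).
Proof.
move=> [u uP].
have /ideal_gen_loc_clear[m [g [ag gE]]] :
    ideal_gen [seq to_loc t x | x <- a] u.
  by apply/uP/mem_ideal_gen; rewrite inE.
have dv x : x \in a -> exists N, divides g (t ^+ N * x).
  move=> xa.
  have /uP/ideal_gen1P[v vE] := mem_ideal_gen (map_f (to_loc t) xa).
  have [n [w wE]] := loc_clear v.
  have /to_loc_eq[k kE] : to_loc t (t ^+ n * (t ^+ m * x)) = to_loc t (w * g).
    by rewrite !rmorphM /= -wE -gE vE; ring.
  (* [m] clears the generator [u], [n] the coefficient [v], and [k] absorbs the [t]-torsion lost in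
     [A[1/t]]. *)
  exists (k + n + m)%N; exists (t ^+ k * w).
  by rewrite -mulrA -kE !exprD; ring.
suff [N NP] : exists N, forall x, x \in a -> divides g (t ^+ N * x).
  by exists N, g.
elim: {uP ag} a dv => [|x a IHa] dv; first by exists 0%N.
have [|N NP] := IHa; first by move=> y ya; apply: dv; rewrite inE ya orbT.
have [|M MP] := dv x; first by rewrite inE eqxx.
exists (M + N)%N => y; rewrite exprD inE => /predU1P[->|/NP]; last first.
  by rewrite -mulrA; apply: dividesMl.
by rewrite mulrAC mulrC; apply: dividesMl.
Qed.

(** * Divisorial invertibility and local principality *)

Lemma zero_locally_principal s a :
  (forall x, x \in a -> x = 0) -> locally_principal s a.
Proof.
move=> a0 t _; apply: (principal_divides (ideal_gen0 _)) => _ /mapP[x /a0-> ->].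
by rewrite rmorph0; apply: divides0.
Qed.

Lemma div_invertible_locally_principal a :
    integral_ring A -> div_invertible a ->
  exists s, depth_ge2 s /\ locally_principal s a.
Proof.
move=> hA [_ [b [g gcdg]]]; have [greg preg gcdp] := gcdg.
have /choice[q qE] : forall y, exists z, y \in prod_gens a b -> y = z * g.
  move=> y; have [yp|_] := boolP (y \in prod_gens a b); last by exists 0.
  have [/(_ (1 * y) (map_f _ yp))[z zE] _] := gcdp 1 (@lreg1 _).
  by exists z; rewrite -[y]mul1r zE mul1r.
exists [seq q y | y <- prod_gens a b]; split.
  exact: strong_gcd_depth_ge2 gcdg _.
move=> _ /mapP[y yp ->]; have yE := qE y yp; set t := q y in yE *.
have [x [z [xa zb yxz ynz]]] := prod_gensP yp.
(* Listed products are nonzero, so the factor [z] is regular and can be cancelled. *)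
have [z0|zreg] := hA z; first by rewrite yxz z0 mulr0 eqxx in ynz.
apply: (principal_divides (g := to_loc t x)); first exact/mem_ideal_gen/map_f.
move=> _ /mapP[x' x'a ->].
have [t' t'E] : divides g (x' * z).
  have [->|nz] := eqVneq (x' * z) 0; first exact: divides0.
  by exists (q (x' * z)); apply/qE/mem_prod_gens.
have e : t * x' = t' * x.
  (* Multiplied by [z * g], both sides become [(x' * z) * (x * z)]. *)
  apply: zreg; apply: greg.
  transitivity ((x' * z) * (t * g)); first by ring.
  by rewrite -yE yxz t'E; ring.
exists (to_loc t t' * loc_frac t 1 1).
rewrite mulrAC -rmorphM -e rmorphM mulrAC to_loc_inv mul1r //.
Qed.

(** The generator [x0] serves to make every [g_t] nonzero, hence regular, so that [G] is regular. *)
Lemma locally_principal_div_invertible a s x0 :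
    integral_ring A -> faithful (ideal_gen a) -> x0 \in a -> x0 != 0 ->
    depth_ge2 s -> locally_principal s a ->
  div_invertible a.
Proof.
move=> hA fa x0a x0nz s2 sP; split=> //.
have reg x : x != 0 -> GRing.lreg x by case: (hA x) => // -> /eqP.
have /choice[h hP] : forall t, exists Ng : nat * A, t \in s ->
    [/\ ideal_gen a Ng.2, GRing.lreg Ng.2 &
     forall x, x \in a -> divides Ng.2 (t ^+ Ng.1 * x)].
  move=> t; have [ts|_] := boolP (t \in s); last by exists (0%N, 0).
  (* [A[1/0]] is trivial and its descent could give [g = 0]. Here [x0] is taken instead, with
     exponent 1 because [0 ^ 0 = 1]. *)
  have [t0|tnz] := eqVneq t 0.
    exists (1%N, x0) => _; split; [exact: mem_ideal_gen | exact: reg|].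
    by move=> x _; rewrite t0 expr1 mul0r; apply: divides0.
  have [N [g [ag gP]]] := principal_loc_descent (sP t ts).
  exists (N, g) => _; split=> //; apply/reg; apply: contra_neq x0nz => /= g0.
  have [z] := gP _ x0a; rewrite g0 mulr0 => e.
  by have tNreg := lregX (n := N) (reg _ tnz); apply: tNreg; rewrite e mulr0.
pose N t := (h t).1; pose g t := (h t).2.
(* [cof t] is [G / g_t] without division; [rem] removes a single occurrence, so repetitions in [s]
   are harmless. *)
pose cof t := \prod_(r <- rem t s) g r; pose G := \prod_(r <- s) g r.
have GE t : t \in s -> G = g t * cof t by move=> ts; rewrite /G (big_rem t).
exists [seq t ^+ N t * cof t | t <- s], G; split.
- rewrite /G big_seq; apply: (big_ind (@GRing.lreg A)) => [|x y xr yr|t /hP[]//].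
    exact: lreg1.
  exact: lregM.
- by move=> z /prod_gensP[x [y [_ _ _ /reg]]].
move=> x _; split.
  move=> _ /mapP[_ /prod_gensP[y [_ [ya /mapP[t ts ->] -> _]]] ->].
  have [_ _ /(_ y ya)[z zE]] := hP t ts; rewrite -/(N t) -/(g t) in zE.
  exists z; transitivity (x * (t ^+ N t * y) * cof t); first by ring.
  by rewrite zE (GE t ts); ring.
move=> y dv; apply: (depth_ge2_divides_exp (N := N) hA s2) => t ts.
have [ag _ _] := hP t ts; rewrite -/(g t) in ag.
have -> : x * G * t ^+ N t = x * (t ^+ N t * cof t) * g t.
  by rewrite (GE t ts); ring.
(* As [g t] lies in the ideal, it may be replaced by a generator [u], where the common divisor
   hypothesis applies. *)
move: (g t) ag; apply: ideal_gen_ind => [|u v du dv'|c u ua].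
- by rewrite mulr0; apply: divides0.
- by rewrite mulrDr; apply: dividesD.
rewrite mulrCA; apply: dividesMl; set w := _ * cof t.
have -> : x * w * u = x * (u * w) by ring.
have [->|nz] := eqVneq (u * w) 0; first by rewrite mulr0; apply: divides0.
by apply/dv/map_f/mem_prod_gens => //; apply: map_f.
Qed.

Lemma trivial_div_invertible a : (forall x, x = 0 :> A) -> div_invertible a.
Proof.
move=> A0; split=> [x _|]; first exact: A0.
exists [::], 1; split=> [|y _|x _]; [exact: lreg1 | |].
  by move=> u v _; rewrite [u]A0 [v]A0.
by split=> [y _|y _]; exists 0; apply/eqP; rewrite -subr_eq0; apply/eqP/A0.
Qed.

End LocalPrincipality.

Theorem mainTheorem10 (A : comPzRingType) (hA : integral_ring A) :
  (forall a : seq A, faithful (ideal_gen a) ->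
     (div_invertible a <-> exists s : seq A, depth_ge2 s /\ locally_principal s a))
  /\
  (ring_with_divisors A <->
     forall a : seq A, exists s : seq A, depth_ge2 s /\ locally_principal s a).
Proof.
have zero_or (a : seq A) :
    (forall x, x \in a -> x = 0) \/ exists2 x, x \in a & x != 0.
  have [/hasP[x xa nz]|/hasPn a0] := boolP (has (fun x => x != 0) a).
    by right; exists x.
  by left=> x /a0; rewrite negbK => /eqP.
have part1 (a : seq A) : faithful (ideal_gen a) ->
    (div_invertible a <-> exists s : seq A, depth_ge2 s /\ locally_principal s a).
  move=> fa; split=> [|[s [s2 sP]]]; first exact: div_invertible_locally_principal.
  have [a0|[x0 x0a x0nz]] := zero_or a; last first.
    exact: locally_principal_div_invertible x0a x0nz s2 sP.
  (* Every element annihilates the zero ideal, so faithfulness makes the ring trivial. *)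
  apply: trivial_div_invertible => x; apply: fa.
  apply: ideal_gen_ind => [|y z y0 z0|c y /a0->]; rewrite ?mulr0 //.
  by rewrite mulrDr y0 z0 addr0.
split=> //; split=> [[_ rd] a|lp].
  have [a0|[x0 x0a x0nz]] := zero_or a.
    (* The zero ideal is outside the definition of a ring with divisors, but is principal in every
       localization. *)
    exists [:: 1]; split; [exact: depth_ge2_one | exact: zero_locally_principal].
  have da : div_invertible a.
    by apply: rd; exists x0; [apply: mem_ideal_gen | apply/eqP].
  by apply/part1 => //; case: da.
(* A nonzero ideal is faithful because it contains a regular element. *)
split=> // a [y ay ynz]; apply/part1/lp => x /(_ y ay) xy0.
have [//|yreg] := hA y.
by apply: yreg; rewrite mulr0 mulrC.
Qed.
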